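(* Let $R$ be a von Neumann regular ring and let $T$ be a ring containing $R$ as a subring. Then $T$ is a minimal ring extension of $R$ if and only if there exists a maximal ideal $\mathfrak{m}$ of $R$ such that one of the following three conditions holds: (i) $\mathfrak{m}$ is a maximal ideal of $T$ and $T/\mathfrak{m}$ is a minimal field extension of $R/\mathfrak{m}$; (ii) there exists $q\in T\setminus R$ such that $T=R[q]$, $q^2-q\in\mathfrak{m}$, and $\mathfrak{m}q\subseteq R$; (iii) there exists $q\in T\setminus R$ such that $T=R[q]$, $q^2\in R$, $q^3\in R$, and $\mathfrak{m}q\subseteq R$. If any of the three conditions (i), (ii), (iii) holds, then $\mathfrak{m}$ is uniquely determined as $\mathfrak{m}=(R:T)$. Moreover, conditions (i)–(iii) are mutually exclusive.
   Context: All rings are commutative with nonzero identity, and all ring extensions (subrings) and ring homomorphisms are unital. For a proper subring $R$ of a ring $T$, $T$ is called a minimal ring extension of $R$ if there is no ring $S$ with $R\subset S\subset T$, where $\subset$ denotes proper inclusion. A minimal field extension is a field extension that is a minimal ring extension. The conductor of a ring extension $R\subseteq T$ is $(R:T)=\{t\in T : tT\subseteq R\}$. *)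

(* Defs.v *)
From HB Require Import structures.
From mathcomp Require Import all_boot all_order all_algebra ring_quotient.
From mathcomp Require Import boolp.

Set Implicit Arguments.
Unset Strict Implicit.
Unset Printing Implicit Defensive.

Import GRing.Theory.
Local Open Scope ring_scope.
Local Open Scope quotient_scope.

(* Subrings and ideals are boolean predicates on the ambient ring.  In the
   presence of boolp every Prop-valued subset is one (through `[< _ >]), so
   quantifying over {pred T} ranges over all subsets of T. *)

Section Subrings.
Variable T : comNzRingType.
Implicit Types A J R m : {pred T}.

Definition von_neumann_regular A : Prop :=
  {in A, forall x, exists2 y, y \in A & x = x ^+ 2 * y}.

Definition proper_subset A J : Prop :=
  {subset A <= J} /\ exists2 x, x \in J & x \notin A.

Definition minimal_ring_extension A : Prop :=
  [/\ subring_closed A,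
      proper_subset A predT
    & ~ exists S : {pred T},
          [/\ subring_closed S, proper_subset A S & proper_subset S predT]].

Definition subfield_closed A : Prop :=
  subring_closed A /\
  {in A, forall x, x != 0 -> exists2 y, y \in A & x * y = 1}.

Definition minimal_field_extension A : Prop :=
  [/\ subfield_closed A, subfield_closed predT & minimal_ring_extension A].

(* J is an ideal of the subring A, not necessarily of T; ideals of T itself
   are obtained with A := predT. *)
Definition ideal_of A J : Prop :=
  [/\ {subset J <= A}, zmod_closed J & {in A & J, forall a x, a * x \in J}].

Definition maximal_ideal_of A J : Prop :=
  [/\ ideal_of A J,
      proper_subset J A
    & forall I : {pred T},
        ideal_of A I -> proper_subset I A -> {subset J <= I} -> I =i J].

Definition conductor A : {pred T} :=
  [pred t | `[< forall x : T, t * x \in A >]].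

Definition adjoin A (q : T) : {pred T} :=
  [pred t | `[< exists2 p : {poly T}, p \is a polyOver A & t = p.[q] >]].

End Subrings.

Section Conditions.
Variable T : comNzRingType.
Implicit Types A R m : {pred T}.

(* For an ideal J of T contained in the subring A, this is A/J: its elements
   are the cosets a + J with a in A, viewed inside T/J. *)
Definition quotient_subring (J : idealr T) A : {pred {ideal_quot J}} :=
  [pred y | `[< exists2 a, a \in A & y = \pi_{ideal_quot J} a >]].

Arguments quotient_subring J A : clear implicits.

(* The existential over I packages m with the idealr structure that the
   quotient type T/m requires. *)
Definition field_case R m : Prop :=
  maximal_ideal_of predT m /\
  exists2 I : idealr T, I =i m
    & minimal_field_extension (quotient_subring I R).

Definition idempotent_case R m : Prop :=
  exists q : T,
    [/\ q \notin R, adjoin R q =i predT, q ^+ 2 - q \in m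
      & {in m, forall x, x * q \in R}].

Definition nilpotent_case R m : Prop :=
  exists q : T,
    [/\ q \notin R, adjoin R q =i predT, q ^+ 2 \in R, q ^+ 3 \in R
      & {in m, forall x, x * q \in R}].

End Conditions.

(* Main.v *)
Require Import Defs.
From HB Require Import structures.
From mathcomp Require Import all_boot all_order all_algebra ring_quotient.
From mathcomp Require Import boolp ring.

(** Write C for the conductor (R : T).  In all three cases m is a T-ideal
    inside R, so m lies in C, and maximality of m forces m = C as soon as
    R <> T ([maximal_conductor]).  Everything then takes place in T/C over
    the field R/C.

    From right to left.  Case (i) is the correspondence between rings
    containing I and rings of the quotient by I ([quotient_minimal]).  In
    cases (ii) and (iii) q satisfies a monic quadratic equation over R, so
    T = R + R q; then T/C is a vector space of dimension 2 over R/C, and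
    leaves no room for a ring strictly in between ([quadratic_minimal]).

    From left to right.  Von Neumann regularity enters once, to show that
    R/C is a field.  For an idempotent e of R, the ring of those t with
    t e in R is R or T; in the first case 1 - e is in C, in the second e is
    ([idempotent_conductor]).  Every x in R is a multiple of an idempotent
    e = x y, so when x is outside C, 1 - x y belongs to C and x is invertible
    modulo C ([regular_conductor_field]).  This replaces the general theory
    that sorts minimal extensions into finite ones and flat epimorphisms.

    There remain the minimal extensions of the field k = R/C
    ([minimal_trichotomy]).  If T/C is not a field, pick in it a nonzero
    nonunit x; it is not in k.  If x^2 is in k, it is zero, which is
    case (iii).  Otherwise k[x^2] is everything by minimality, so
    x = c + x^2 g with c in k; c is a multiple of the nonunit x, so c = 0,
    and x g is an idempotent outside k, which is case (ii).

    For mutual exclusion: T/C is a field in case (i), it is reduced but not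
    a domain in case (ii), and it is not reduced in case (iii). *)

Set Implicit Arguments.
Unset Strict Implicit.
Unset Printing Implicit Defensive.

Import GRing.Theory.
Local Open Scope ring_scope.
Local Open Scope quotient_scope.

(** * Subrings and residue fields *)

Lemma pred_ext (T : Type) (A B : {pred T}) : A =i B -> A = B.
Proof. by move=> AB; apply: funext => x; exact: AB. Qed.

(** Packing a closure hypothesis as a structure makes the generic closure
    lemmas, and those on polynomials over a subring, apply to [A]. *)
Definition subring_pack (T : comNzRingType) (A : {pred T})
    (subA : subring_closed A) : subringClosed T :=
  HB.pack (A : T -> bool) (GRing.isSubringClosed.Build T A subA).

Section ResidueFields.
Variable T : comNzRingType.
Implicit Types (A : {pred T}) (C : idealr T).

(** That A/C is a field, said by representatives so that most arguments can
    stay inside [T]; [quotient_subfield] links it to the quotient ring. *)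
Definition field_mod A C : Prop :=
  {in A, forall x, x \notin C -> exists2 y, y \in A & 1 - x * y \in C}.

Lemma field_mod_prime A C x y :
  field_mod A C -> x \in A -> x * y \in C -> x \in C \/ y \in C.
Proof.
move=> fA Ax Cxy; have [Cx|Cx] := boolP (x \in C); first by left.
have [u _ Cu] := fA x Ax Cx; right.
have -> : y = y * (1 - x * u) + u * (x * y) by ring.
by apply: rpredD; exact: idealMr.
Qed.

Lemma maximal_idealP (A : subringClosed T) C : {subset C <= A} ->
  maximal_ideal_of A C <-> field_mod A C.
Proof.
move=> CA; split; last first.
  move=> fA; split; first split => //.
  - by split=> [|x y Cx Cy]; rewrite ?rpred0 ?rpredB.
  - by move=> a x _ Cx; rewrite idealMr.
  - by split=> //; exists 1; rewrite ?rpred1 ?idealr1.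
  move=> I [IA [_ IB] IM] [_ [x Ax Ix]] CI y; apply/idP/idP; last exact: CI.
  move=> Iy; apply: contraNT Ix => Cy.
  have [u Au Cu] := fA y (IA _ Iy) Cy.
  have -> : x = x * (1 - y * u) - - (x * u) * y by ring.
  by apply: IB; apply: IM; rewrite ?rpredN ?rpredM //; exact: CI.
move=> [_ _ maxC] x Ax Cx.
(* The ideal C + A x; it contains 1 exactly when x is invertible modulo C. *)
pose I : {pred T} :=
  [pred t | (t \in A) && `[< exists2 a, a \in A & t - a * x \in C >]].
suff /andP[_ /asboolP [a Aa Ca]] : 1 \in I by exists a; rewrite 1?mulrC.
have CI : {subset C <= I}.
  move=> c Cc; rewrite inE CA //=; apply/asboolP; exists 0; rewrite ?rpred0 //.
  by rewrite mul0r subr0.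
apply: contraNT Cx => I1; rewrite -(maxC I) //.
- rewrite inE Ax; apply/asboolP; exists 1; rewrite ?rpred1 //.
  by rewrite mul1r subrr rpred0.
- split; first by move=> t /andP[].
    split=> [|s t /andP[As /asboolP[a Aa Ca]] /andP[At /asboolP[b Ab Cb]]].
      by rewrite CI ?rpred0.
    rewrite inE rpredB //=; apply/asboolP; exists (a - b); first exact: rpredB.
    have -> : s - t - (a - b) * x = (s - a * x) - (t - b * x) by ring.
    by rewrite rpredB.
  move=> s t As /andP[At /asboolP[b Ab Cb]].
  rewrite inE rpredM //=; apply/asboolP; exists (s * b); first exact: rpredM.
  by rewrite -mulrA -mulrBr idealMr.
- split; first by move=> t /andP[].
  by exists 1; rewrite ?rpred1.
Qed.

End ResidueFields.

(** * Correspondence between subrings of T containing I and of T/I *)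

Section Quotient.
Variables (T : comNzRingType) (I : idealr T).
Local Notation Q := {ideal_quot I}.
Local Notation pi := (\pi_{ideal_quot I}).
Local Notation quo := (@quotient_subring T I).

Lemma pi_eq s t : (pi s = pi t) <-> (s - t \in I).
Proof. by rewrite Quotient.idealrBE; split=> [->|/eqP]. Qed.

Lemma pi_neq0 t : (pi t != 0) = (t \notin I).
Proof.
congr negb; apply/eqP/idP; rewrite -(rmorph0 pi).
  by move/pi_eq; rewrite subr0.
by move=> It; apply/pi_eq; rewrite subr0.
Qed.

Lemma pi_surj (y : Q) : exists t, y = pi t.
Proof. by exists (repr y); rewrite reprK. Qed.

(** An [A] that contains [I] is saturated, so passing to the quotient loses
    nothing; the correspondence theorem rests on this. *)
Lemma pi_quotient (A : subringClosed T) t :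
  {subset I <= A} -> (pi t \in quo A) = (t \in A).
Proof.
move=> IA; apply/asboolP/idP => [[a Aa /pi_eq /IA]|At]; last by exists t.
by move=> Ata; rewrite -(subrK a t) rpredD.
Qed.

Lemma quotient_subring_closed (A : subringClosed T) :
  subring_closed (quo A).
Proof.
split.
- by apply/asboolP; exists 1; rewrite ?rpred1 ?rmorph1.
- move=> _ _ /asboolP[a Aa ->] /asboolP[b Ab ->]; apply/asboolP.
  by exists (a - b); rewrite ?rpredB ?rmorphB.
move=> _ _ /asboolP[a Aa ->] /asboolP[b Ab ->]; apply/asboolP.
by exists (a * b); rewrite ?rpredM ?rmorphM.
Qed.

Lemma quotient_minimal (A : subringClosed T) : {subset I <= A} ->
  minimal_ring_extension (quo A) <-> minimal_ring_extension A.
Proof.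
move=> IA; split=> [[_ [_ [y _ Ay]] minA]|[_ [_ [x _ Ax]] minA]].
  have [x xy] := pi_surj y; rewrite xy pi_quotient // in Ay.
  split; [by split; [exact: rpred1|exact: rpredB|exact: rpredM] | |].
    by split=> //; exists x.
  move=> [S [subS [AS [s Ss As]] [_ [t _ St]]]]; apply: minA.
  pose S' := subring_pack subS; have IS : {subset I <= S'} by move=> c /IA /AS.
  exists (quo S'); split; first exact: quotient_subring_closed.
    split; first by move=> _ /asboolP[a Aa ->]; rewrite pi_quotient //; exact: AS.
    by exists (pi s); rewrite pi_quotient.
  by split=> //; exists (pi t); rewrite ?pi_quotient.
split; first exact: quotient_subring_closed.
  by split=> //; exists (pi x); rewrite ?pi_quotient.
move=> [S [[S1 SB SM] [AS [y Sy Ay]] [_ [z _ Sz]]]]; apply: minA.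
have [[s ys] [t zt]] := (pi_surj y, pi_surj z).
(* A ring of the quotient pulls back to one between A and T. *)
pose P : {pred T} := [pred a | pi a \in S].
exists P; split.
- split; rewrite ?inE ?rmorph1 // => a b.
    by rewrite !inE rmorphB; exact: SB.
  by rewrite !inE rmorphM; exact: SM.
- split; first by move=> a Aa; rewrite inE AS ?pi_quotient.
  by exists s; [rewrite inE -ys|rewrite -pi_quotient // -ys].
by split=> //; exists t; rewrite // inE -zt.
Qed.

Lemma quotient_subfield (A : subringClosed T) : {subset I <= A} ->
  subfield_closed (quo A) <-> field_mod A I.
Proof.
move=> IA; split=> [[_ fA] x Ax Ix|fA].
  have [||_ /asboolP[y Ay ->]] := fA (pi x).
  - by rewrite pi_quotient.
  - by rewrite pi_neq0.
  by rewrite -rmorphM -(rmorph1 pi) => /esym/pi_eq; exists y.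
split; first exact: quotient_subring_closed.
move=> _ /asboolP[x Ax ->]; rewrite pi_neq0 => Ix.
have [y Ay Ixy] := fA x Ax Ix; exists (pi y); first by rewrite pi_quotient.
by rewrite -rmorphM -(rmorph1 pi); apply/esym/pi_eq.
Qed.

Lemma predT_subring_closed (S : pzRingType) : subring_closed (predT : {pred S}).
Proof. by []. Qed.

Lemma quotient_minimal_field (A : subringClosed T) : {subset I <= A} ->
  minimal_field_extension (quo A) <->
  [/\ field_mod A I, field_mod predT I & minimal_ring_extension A].
Proof.
move=> IA.
pose P := subring_pack (@predT_subring_closed T).
have IP : {subset I <= P} by [].
have quoT : quo P = predT.
  by apply: pred_ext => y; have [t ->] := pi_surj y; rewrite pi_quotient.
rewrite /minimal_field_extension -quoT.
have qA := quotient_subfield IA; have qP := quotient_subfield IP.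
by have mA := quotient_minimal IA; split=> -[/qA ? /qP ? /mA ?].
Qed.

End Quotient.

(** * Conductor and simple extensions *)

Section Conductor.
Variables (T : comNzRingType) (R : subringClosed T).

Lemma conductor_sub : {subset conductor R <= R}.
Proof. by move=> c /asboolP/(_ 1); rewrite mulr1. Qed.

Lemma ideal_sub_conductor (J : idealr T) :
  {subset J <= R} -> {subset J <= conductor R}.
Proof.
move=> JR c Jc; apply/asboolP=> x; apply: JR.
by rewrite mulrC idealMr.
Qed.

Lemma conductor_idealr_closed x : x \notin R -> idealr_closed (conductor R).
Proof.
move=> Rx; split.
- by apply/asboolP=> t; rewrite mul0r rpred0.
- by apply: contra Rx => /asboolP/(_ x); rewrite mul1r.
move=> a u v /asboolP cu /asboolP cv; apply/asboolP=> t.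
by rewrite mulrDl (mulrC a) -mulrA rpredD.
Qed.

Definition conductor_ideal x (Rx : x \notin R) : idealr T :=
  HB.pack (conductor R : T -> bool)
    (isIdealr.Build T _ (conductor_idealr_closed Rx)).

(** The conductor is a proper ideal of [R] when [R] is not [T], so a maximal
    ideal cannot be strictly smaller. *)
Lemma maximal_conductor (m : {pred T}) x : x \notin R ->
  maximal_ideal_of R m -> {subset m <= conductor R} -> m = conductor R.
Proof.
move=> Rx [_ _ maxm] mC; apply/esym/pred_ext/maxm => //.
  split; [exact: conductor_sub | | ].
    split; first exact: (rpred0 (conductor_ideal Rx)).
    exact: (@rpredB _ (conductor_ideal Rx)).
  by move=> a c _; exact: (@idealMr _ (conductor_ideal Rx)).
split; first exact: conductor_sub.
exists 1; rewrite ?rpred1 //.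
by rewrite -[conductor R]/(conductor_ideal Rx : {pred T}) idealr1.
Qed.

Lemma adjoin_subring_closed q : subring_closed (adjoin R q).
Proof.
split.
- by apply/asboolP; exists 1; rewrite ?rpred1 // hornerC.
- move=> _ _ /asboolP[f Rf ->] /asboolP[g Rg ->]; apply/asboolP.
  by exists (f - g); [exact: rpredB|rewrite hornerD hornerN].
move=> _ _ /asboolP[f Rf ->] /asboolP[g Rg ->]; apply/asboolP.
by exists (f * g); [exact: rpredM|rewrite hornerM].
Qed.

Lemma sub_adjoin q : {subset R <= adjoin R q}.
Proof.
by move=> a Ra; apply/asboolP; exists a%:P; rewrite ?polyOverC ?hornerC.
Qed.

Lemma mem_adjoin q : q \in adjoin R q.
Proof.
by apply/asboolP; exists 'X; rewrite ?hornerX // polyOverX.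
Qed.

(** Splitting off the constant term; [g] is left arbitrary because only the
    divisibility of [t - a] by [q] matters to the trichotomy. *)
Lemma adjoin_constant_term q t : t \in adjoin R q ->
  exists2 a, a \in R & exists g, t = a + q * g.
Proof.
move=> /asboolP[f /polyOverP Rf ->]; exists f`_0; first exact: Rf.
elim/poly_ind: f {Rf} => [|f c _].
  by exists 0; rewrite coef0 horner0 mulr0 addr0.
by exists f.[q]; rewrite hornerMXaddC coefD coefMX coefC /= add0r addrC mulrC.
Qed.

Lemma adjoin_minimal q : minimal_ring_extension R -> q \notin R ->
  adjoin R q =i predT.
Proof.
move=> [_ _ minR] Rq t; rewrite inE; apply: contrapT => /negP qt.
apply: minR; exists (adjoin R q); split; first exact: adjoin_subring_closed.
  by split; [exact: sub_adjoin|exists q; rewrite ?mem_adjoin].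
by split=> //; exists t.
Qed.

(** A monic quadratic equation for [q] reduces every polynomial in [q] to a
    linear one.  The cases of the theorem have b = 1 and b = 0. *)
Lemma adjoin_quadratic q a b : a \in R -> b \in R -> q ^+ 2 = a + b * q ->
  adjoin R q =i predT ->
  forall t, exists r s, [/\ r \in R, s \in R & t = r + s * q].
Proof.
move=> Ra Rb q2 Tq t; have /asboolP[f /polyOverP Rf ->] : t \in adjoin R q.
  by rewrite Tq.
elim/poly_ind: f Rf => [|f c IH] Rfc.
  by exists 0, 0; rewrite !rpred0 horner0 mul0r addr0.
have [i|r [s [Rr Rs rs]]] := IH.
  by have := Rfc i.+1; rewrite coefD coefMX coefC /= addr0.
have Rc : c \in R by have := Rfc 0; rewrite coefD coefMX coefC /= add0r.
exists (c + s * a), (r + s * b); split; rewrite ?(rpredD, rpredM) //.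
rewrite hornerMXaddC rs.
have -> : (r + s * q) * q + c = r * q + s * q ^+ 2 + c by ring.
by rewrite q2; ring.
Qed.

End Conductor.

(** * Extensions with maximal conductor *)

Section Cases.
Variables (T : comNzRingType) (R : subringClosed T) (C : idealr T).
Hypothesis CE : (C : {pred T}) = conductor R.
Hypothesis maxC : maximal_ideal_of R C.

Let conductor_subR : {subset C <= R}.
Proof. by rewrite CE; exact: conductor_sub. Qed.

Let conductorM x c : c \in C -> c * x \in R.
Proof. by rewrite CE => /asboolP/(_ x). Qed.

Let fieldR : field_mod R C.
Proof. exact/(maximal_idealP conductor_subR). Qed.

(** Linear independence of 1 and [q] over the field R/C: a coefficient of [q]
    outside [C] could be inverted modulo [C], putting [q] in [R]. *)
Lemma slope_in_conductor q r s : q \notin R -> r \in R -> s \in R ->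
  r + s * q \in R -> s \in C.
Proof.
move=> Rq Rr Rs Rrsq; apply: contraNT Rq => Cs.
have [u Ru Cu] := fieldR Rs Cs.
have -> : q = (1 - s * u) * q + (r + s * q - r) * u by ring.
apply: rpredD; first exact: conductorM.
by apply: rpredM => //; exact: rpredB.
Qed.

(** T/C has dimension 2 over R/C: an element r + s q of an intermediate ring
    that is outside [R] has s invertible modulo [C], so [q] itself is in that
    ring. *)
Lemma quadratic_minimal q : q \notin R ->
  (forall t, exists r s, [/\ r \in R, s \in R & t = r + s * q]) ->
  minimal_ring_extension R.
Proof.
move=> Rq span; split.
- by split; [exact: rpred1|exact: rpredB|exact: rpredM].
- by split=> //; exists q.
move=> [S [subS [RS [x Sx Rx]] [_ [t _]]]]; apply/negP/negPn.
pose S' := subring_pack subS.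
have [r [s [Rr Rs xrs]]] := span x.
have Cs : s \notin C.
  apply: contra Rx => Cs; rewrite xrs rpredD // conductorM //.
have [u Ru Cu] := fieldR Rs Cs.
have Sq : q \in S'.
  have -> : q = (1 - s * u) * q + (x - r) * u by rewrite xrs; ring.
  apply: rpredD; first exact/RS/conductorM.
  by apply: rpredM; [apply: rpredB => //; exact: RS|exact: RS].
have [a [b [Ra Rb ->]]] := span t.
by apply: (@rpredD _ S'); [|apply: (@rpredM _ S') => //]; exact: RS.
Qed.

(** If q^2 were outside [C] it would be invertible modulo [C], and
    q = q^3 / q^2 would come from [R]. *)
Lemma nilpotent_case_square : nilpotent_case R C ->
  exists2 q, q \notin R & q ^+ 2 \in C.
Proof.
move=> [q [Rq _ Rq2 Rq3 _]]; exists q => //; apply: contraNT Rq => Cq2.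
have [u Ru Cu] := fieldR Rq2 Cq2.
have -> : q = (1 - q ^+ 2 * u) * q + q ^+ 3 * u by ring.
by apply: rpredD; [exact: conductorM|exact: rpredM].
Qed.

Lemma field_reduced x : field_mod predT C -> x ^+ 2 \in C -> x \in C.
Proof. by move=> fT; rewrite expr2 => /(field_mod_prime fT isT) []. Qed.

(** Modulo [C] the square of a + b q is a^2 + (2 a b + b^2) q; if it vanishes,
    so does a^2, hence a, hence b^2, hence b.  (T/C is a product of two copies
    of R/C.) *)
Lemma idempotent_reduced q x : q \notin R -> q ^+ 2 - q \in C ->
  (forall t, exists r s, [/\ r \in R, s \in R & t = r + s * q]) ->
  x ^+ 2 \in C -> x \in C.
Proof.
move=> Rq Cq span; have [a [b [Ra Rb ->]]] := span x => Cx.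
have redR y : y \in R -> y ^+ 2 \in C -> y \in C.
  by move=> Ry; rewrite expr2 => /(field_mod_prime fieldR Ry) [].
have Cx' : a ^+ 2 + (2 * a * b + b ^+ 2) * q \in C.
  have -> : a ^+ 2 + (2 * a * b + b ^+ 2) * q
            = (a + b * q) ^+ 2 - b ^+ 2 * (q ^+ 2 - q) by ring.
  by apply: rpredB => //; exact: idealMr.
have Cs : 2 * a * b + b ^+ 2 \in C.
  apply: (slope_in_conductor Rq (r := a ^+ 2)); last exact: conductor_subR.
    exact: rpredX.
  by rewrite rpredD ?rpredX // !rpredM // rpred_nat.
have Ca : a \in C.
  apply: redR => //; rewrite -(addrK ((2 * a * b + b ^+ 2) * q) (a ^+ 2)).
  by apply: rpredB => //; rewrite mulrC; exact: idealMr.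
have Cb : b \in C.
  apply: redR => //; have -> : b ^+ 2 = 2 * a * b + b ^+ 2 - 2 * b * a by ring.
  by apply: rpredB => //; exact: idealMr.
by apply: rpredD => //; rewrite mulrC; exact: idealMr.
Qed.

Lemma field_case_conductor : field_mod predT C -> minimal_ring_extension R ->
  field_case R C.
Proof.
move=> fT minR; split; last by exists C => //; apply/quotient_minimal_field.
pose P := subring_pack (@predT_subring_closed T).
exact/(@maximal_idealP _ P).
Qed.

(** Any nonzero nonunit x of T/C produces the generator of case (ii) or of
    case (iii), according to whether x^2 generates T/C over R/C. *)
Lemma minimal_trichotomy : minimal_ring_extension R ->
  [\/ field_case R C, idempotent_case R C | nilpotent_case R C].
Proof.
move=> minR; have [fT|] := pselect (field_mod predT C).
  by apply: Or31; exact: field_case_conductor.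
move=> /existsNP[x] /not_implyP[_] /not_implyP[Cx nox].
have nounit y : 1 - x * y \notin C.
  by apply/negP=> Cy; apply: nox; exists y.
have Rx : x \notin R.
  apply/negP=> Rx; have [y _ Cy] := fieldR Rx Cx.
  by move/negP: (nounit y).
have adjT := adjoin_minimal minR.
have [Rx2|Rx2] := boolP (x ^+ 2 \in R).
  have Cx2 : x ^+ 2 \in C.
    apply: contraT => Cx2; have [y _] := fieldR Rx2 Cx2.
    by rewrite expr2 -mulrA (negbTE (nounit _)).
  apply: Or33; exists x; split=> //; first exact: adjT.
    by rewrite exprSr; exact: conductorM.
  by move=> c Cc; exact: conductorM.
(* Here x^2 generates T, so x = c + x^2 g.  A unit c would make x a unit, so
   c vanishes modulo C, and x = x^2 g there makes x g idempotent. *)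
have : x \in adjoin R (x ^+ 2) by rewrite adjT.
move=> /adjoin_constant_term[c Rc [g xg]].
have cE : c = x - x ^+ 2 * g by rewrite {1}xg addrK.
have Cc : c \in C.
  apply: contraT => Cc; have [d Rd Cd] := fieldR Rc Cc.
  have := nounit ((1 - x * g) * d).
  by have -> : x * ((1 - x * g) * d) = c * d; [rewrite cE; ring|rewrite Cd].
apply: Or32; exists (x * g).
(* An idempotent of the field R/C would be 0 or 1, but x g is neither: that
   would make x zero or a unit modulo C. *)
have Re : x * g \notin R.
  apply/negP=> Re; have [Ce|Ce] := boolP (x * g \in C).
    apply: (negP Cx); rewrite xg; apply: rpredD => //.
    by rewrite expr2 -mulrA; exact: idealMr.
  have [y _] := fieldR Re Ce.
  by rewrite -mulrA (negbTE (nounit _)).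
split=> //; first exact: adjT.
  have -> : (x * g) ^+ 2 - x * g = - g * c; last exact: idealMr.
  by rewrite cE; ring.
by move=> y Cy; exact: conductorM.
Qed.

End Cases.

(** * Minimal extensions of a von Neumann regular ring *)

Section Classification.
Variables (T : comNzRingType) (R : subringClosed T).

Lemma idempotent_quadratic m q : maximal_ideal_of R m -> q ^+ 2 - q \in m ->
  adjoin R q =i predT ->
  forall t, exists r s, [/\ r \in R, s \in R & t = r + s * q].
Proof.
move=> [[mR _ _] _ _] mq; apply: (adjoin_quadratic (mR _ mq) (rpred1 R)).
by ring.
Qed.

(** From m q in [R] and T = R + R q one gets m T in [R]. *)
Lemma span_conductor m q : maximal_ideal_of R m -> q \notin R ->
  (forall t, exists r s, [/\ r \in R, s \in R & t = r + s * q]) ->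
  {in m, forall x, x * q \in R} -> m = conductor R.
Proof.
move=> maxm Rq span mq; apply: (maximal_conductor Rq) => // c mc.
have [[mR _ _] _ _] := maxm; have Rc := mR c mc.
apply/asboolP=> t; have [r [s [Rr Rs ->]]] := span t.
have -> : c * (r + s * q) = c * r + s * (c * q) by ring.
by apply: rpredD; apply: rpredM => //; exact: mq.
Qed.

Lemma case_minimal_conductor m : maximal_ideal_of R m ->
  [\/ field_case R m, idempotent_case R m | nilpotent_case R m] ->
  minimal_ring_extension R /\ m = conductor R.
Proof.
move=> maxm.
have quad q : q \notin R -> {in m, forall x, x * q \in R} ->
    (forall t, exists r s, [/\ r \in R, s \in R & t = r + s * q]) ->
    minimal_ring_extension R /\ m = conductor R.
  move=> Rq mq span; have mE := span_conductor maxm Rq span mq.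
  split=> //; apply: (quadratic_minimal (C := conductor_ideal Rq) _ _ Rq) => //.
  by rewrite mE in maxm.
case=> [[_ [I /pred_ext Im minI]] | [q [Rq Tq mq2 mq]] | [q [Rq Tq Rq2 _ mq]]].
- rewrite -Im in maxm *; have IR : {subset I <= R} by have [[]] := maxm.
  have [_ _ minR] := (quotient_minimal_field IR).1 minI; split=> //.
  have [_ [_ [x _ Rx]] _] := minR.
  by apply: (maximal_conductor Rx maxm); exact: ideal_sub_conductor.
- exact: (quad q Rq mq (idempotent_quadratic maxm mq2 Tq)).
apply: (quad q Rq mq (adjoin_quadratic Rq2 (rpred0 R) _ Tq)).
by rewrite mul0r addr0.
Qed.

(** The elements [t] with [t * e] in [R] form a ring because [e] is idempotent.
    It contains [R] and (1 - e) T, so by minimality either it is [T], or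
    (1 - e) T lies in [R]. *)
Lemma idempotent_conductor e : minimal_ring_extension R ->
  e \in R -> e ^+ 2 = e -> e \in conductor R \/ 1 - e \in conductor R.
Proof.
move=> [_ _ minR] Re ee.
pose S : {pred T} := [pred t | t * e \in R].
have [Se|/existsNP[t /negP St]] := pselect (forall t, t \in S).
  by left; apply/asboolP => t; rewrite mulrC; exact: Se.
right; apply/asboolP => x; apply: contrapT => /negP Rx; apply: minR.
exists S; split.
- split; rewrite ?inE ?mul1r // => u v; rewrite !inE => Su Sv.
    by rewrite mulrBl rpredB.
  have -> : u * v * e = (u * e) * (v * e) by rewrite -[in LHS]ee; ring.
  exact: rpredM.
- split; first by move=> u Ru; rewrite inE rpredM.
  exists ((1 - e) * x) => //; rewrite inE.
  have -> : (1 - e) * x * e = (e - e ^+ 2) * x by ring.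
  by rewrite ee subrr mul0r rpred0.
by split=> //; exists t.
Qed.

(** If a = a^2 y then a y is idempotent and generates the same ideal as [a]; so
    it is outside the conductor when [a] is, and its complement is inside. *)
Lemma regular_conductor_field x (Rx : x \notin R) : von_neumann_regular R ->
  minimal_ring_extension R -> field_mod R (conductor_ideal Rx).
Proof.
move=> regR minR a Ra Ca; have [y Ry ay] := regR a Ra; exists y => //.
have [| |Ce|//] := idempotent_conductor minR (e := a * y).
- exact: rpredM.
- by rewrite [in RHS]ay; ring.
move/negP: Ca; case; rewrite ay.
have -> : a ^+ 2 * y = a * (a * y) by ring.
exact: (@idealMr _ (conductor_ideal Rx)).
Qed.

Lemma cases_exclusive m : maximal_ideal_of R m ->
  [/\ ~ (field_case R m /\ idempotent_case R m),
      ~ (field_case R m /\ nilpotent_case R m)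
    & ~ (idempotent_case R m /\ nilpotent_case R m)].
Proof.
move=> maxm.
have fieldC : field_case R m -> exists2 C : idealr T,
    (C : {pred T}) = m & field_mod predT C.
  move=> [_ [I /pred_ext Im minI]]; exists I => //.
  have IR : {subset I <= R} by rewrite Im; have [[]] := maxm.
  by have [] := (quotient_minimal_field IR).1 minI.
split=> -[].
- move=> mF mI; have [C CE fC] := fieldC mF; move: mI => [q [Rq _ + _]].
  have CR : {subset C <= R} by rewrite CE; have [[]] := maxm.
  have -> : q ^+ 2 - q = q * (q - 1) by ring.
  rewrite -CE => /(field_mod_prime fC isT) [] /CR; first by rewrite (negbTE Rq).
  by move=> Rq1; apply: (negP Rq); rewrite -(subrK 1 q) rpredD ?rpred1.
- move=> mF mN; have [_ mE] := case_minimal_conductor maxm (Or31 _ _ mF).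
  have [C CE fC] := fieldC mF; rewrite -CE in maxm mN mE.
  have [q Rq Cq] := nilpotent_case_square mE maxm mN.
  apply: (negP Rq); have [[CR _ _] _ _] := maxm.
  exact/CR/field_reduced.
move=> mI mN; have [_ mE] := case_minimal_conductor maxm (Or32 _ _ mI).
move: mI => [q [Rq Tq mq _]]; have span := idempotent_quadratic maxm mq Tq.
pose C := conductor_ideal Rq; have CE : (C : {pred T}) = conductor R by [].
rewrite mE -CE in maxm mN mq.
have [p Rp Cp] := nilpotent_case_square CE maxm mN.
apply: (negP Rp); have [[CR _ _] _ _] := maxm.
exact/CR/(idempotent_reduced CE maxm Rq mq span).
Qed.

End Classification.

Theorem theorem2p2 (T : comNzRingType) (R : {pred T})
    (subR : subring_closed R) (regR : von_neumann_regular R) :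
  [/\ minimal_ring_extension R <->
        exists2 m : {pred T}, maximal_ideal_of R m &
          [\/ field_case R m, idempotent_case R m | nilpotent_case R m],
      forall m : {pred T}, maximal_ideal_of R m ->
        [\/ field_case R m, idempotent_case R m | nilpotent_case R m] ->
        m =i conductor R
    & forall m1 m2 : {pred T},
        maximal_ideal_of R m1 -> maximal_ideal_of R m2 ->
        [/\ ~ (field_case R m1 /\ idempotent_case R m2),
            ~ (field_case R m1 /\ nilpotent_case R m2)
          & ~ (idempotent_case R m1 /\ nilpotent_case R m2)]].
Proof.
rewrite -[R]/(subring_pack subR : {pred T}) in regR *.
move: (subring_pack subR) regR => {subR R} R regR; split.
- split=> [minR|[m maxm mcase]]; last exact: (case_minimal_conductor maxm mcase).1.
  have [_ [_ [x _ Rx]] _] := minR; pose C := conductor_ideal Rx.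
  have maxC : maximal_ideal_of R C.
    apply/maximal_idealP; first exact: conductor_sub.
    exact: regular_conductor_field.
  by exists (C : {pred T}) => //; apply: minimal_trichotomy.
- by move=> m maxm mcase x; rewrite (case_minimal_conductor maxm mcase).2.
move=> m1 m2 max1 max2.
have same : [\/ field_case R m1, idempotent_case R m1 | nilpotent_case R m1] ->
    [\/ field_case R m2, idempotent_case R m2 | nilpotent_case R m2] -> m1 = m2.
  move=> c1 c2.
  have [_ ->] := case_minimal_conductor max1 c1.
  by have [_ ->] := case_minimal_conductor max2 c2.
have [noFI noFN noIN] := cases_exclusive max2.
split=> -[c1 c2].
- by apply: noFI; split=> //; rewrite -same //; [apply: Or31|apply: Or32].
- by apply: noFN; split=> //; rewrite -same //; [apply: Or31|apply: Or33].
by apply: noIN; split=> //; rewrite -same //; [apply: Or32|apply: Or33].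
Qed.
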